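(* For integers $n\ge 2$, the triples $(x,y,k)=(n,1,1-n^3)$ are primitive solutions of $y^2=x^3+k$, and their approximation gain $G_a$ tends to $3/4$ as $n\to\infty$. Let $\mathcal S=\{(n,1,1-n^3): n\ge 2\}$, let $6/11\le\kappa<3/4$ and put $\gamma(\kappa)=\frac3\kappa-\frac52$. Then, for every $\delta\in(0,\gamma(\kappa))$, only finitely many solutions in $\mathcal S$ satisfy $|k|<x^{\gamma(\kappa)-\delta}$, while for every $\varepsilon$ with $0<\varepsilon<3/4-\kappa$, infinitely many solutions in $\mathcal S$ satisfy $G_a>\kappa+\varepsilon$.
   Context: A solution is a triple $(x,y,k)$ of integers with $y^2=x^3+k$, $x\ge 1$, $y\ge 1$ and $k\ne 0$. It is primitive when $\gcd(x,y)=1$. For a solution put $M=\max\{x^3,y^2\}$ and $P=xy|k|$ (one always has $P\ge 2$). The approximation gain of the solution is $G_a=\frac{\log M}{\log P}$. *)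

(* Defs.v *)
From HB Require Import structures.
From mathcomp Require Import all_boot all_order all_algebra.
From mathcomp Require Import all_classical all_reals all_analysis.
Set Implicit Arguments.
Unset Strict Implicit.
Unset Printing Implicit Defensive.
Import Order.TTheory GRing.Theory Num.Theory.
Import numFieldNormedType.Exports.
Local Open Scope classical_set_scope.
Local Open Scope ring_scope.

Definition triple : Type := (int * int * int)%type.

Definition tx (s : triple) : int := s.1.1.
Definition ty (s : triple) : int := s.1.2.
Definition tk (s : triple) : int := s.2.

Definition solution (s : triple) : Prop :=
  [/\ ty s ^+ 2 = tx s ^+ 3 + tk s, 1 <= tx s, 1 <= ty s & tk s != 0].

Definition primitive_solution (s : triple) : Prop :=
  solution s /\ gcdz (tx s) (ty s) = 1.

Definition Msol (s : triple) : int := Num.max (tx s ^+ 3) (ty s ^+ 2).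

Definition Psol (s : triple) : int := tx s * ty s * `|tk s|.

Definition approximation_gain (R : realType) (s : triple) : R :=
  ln (Msol s)%:~R / ln (Psol s)%:~R.

Definition family_triple (n : int) : triple := (n, 1, 1 - n ^+ 3).

Definition family_set : set triple :=
  [set family_triple n | n in [set n : int | 2 <= n]].

Definition gamma_exponent (R : realType) (kappa : R) : R :=
  3 / kappa - 5 / 2.

(* Main.v *)
(** Since [n ^ 4 / 2 <= P < n ^ 4] for [P = n (n ^ 3 - 1)], while [M = n ^ 3],
    every gain of the family lies in the interval from [3 / 4] (excluded) to
    [3 / 4 + ln 2 / ln n]. The hypothesis [6 / 11 <= kappa] gives
    [gamma kappa <= 3], so [|k| < x ^ (gamma - delta)] bounds
    [n ^ 3 / 2 <= n ^ 3 - 1] by a power of [n] with exponent less than 3. *)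

Require Import Defs.
From HB Require Import structures.
From mathcomp Require Import all_boot all_order all_algebra.
From mathcomp Require Import all_classical all_reals all_analysis.
From mathcomp Require Import lra zify.
Set Implicit Arguments.
Unset Strict Implicit.
Unset Printing Implicit Defensive.
Import Order.TTheory GRing.Theory Num.Theory.
Import numFieldNormedType.Exports.
Local Open Scope classical_set_scope.
Local Open Scope ring_scope.

Lemma family_triple_primitive (n : int) :
  2 <= n -> primitive_solution (family_triple n).
Proof.
move=> n2; split; last by rewrite /tx /ty /= gcdz1.
(* This bound makes [k = 1 - n ^ 3] nonzero. *)
have n3 : 8 <= n ^+ 3 :> int.
  by rewrite -[8]/(2 ^+ 3 : int) lerXn2r // nnegrE (le_trans _ n2).
split; rewrite /tx /ty /tk /= ?expr1n //.
- by rewrite addrC subrK.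
- exact: le_trans n2.
- by apply/eqP; lia.
Qed.

Section Gain.
Variable R : realType.
Implicit Type n : nat.

Lemma ln_natX_gt0 n : (2 <= n)%N -> 0 < ln (n%:R : R).
Proof. by move=> n2; rewrite ln_gt0 // ltr1n. Qed.

Lemma natX3_ge8 n : (2 <= n)%N -> 8 <= n%:R ^+ 3 :> R.
Proof. by move=> n2; rewrite -natrX ler_nat -[8%N]/(2 ^ 3)%N leq_exp2r. Qed.

Lemma norm_tk_family n : (2 <= n)%N ->
  (`|tk (family_triple n%:Z)|)%:~R = n%:R ^+ 3 - 1 :> R.
Proof.
move=> n2; rewrite /tk /= intr_norm rmorphB rmorphXn /= distrC ger0_norm //.
by have := natX3_ge8 n2; lra.
Qed.

Lemma gain_family n : (2 <= n)%N ->
  approximation_gain R (family_triple n%:Z) =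
  3 * ln n%:R / ln (n%:R * (n%:R ^+ 3 - 1)).
Proof.
move=> n2; rewrite /approximation_gain /Psol /Msol.
rewrite /ty /= expr1n mulr1 rmorphM /= norm_tk_family // /tx /=.
rewrite max_l; last first.
  by rewrite exprn_ege1 //; lia.
rewrite rmorphXn /= lnXn ?mulr_natl //.
by rewrite ltr0n (leq_trans _ n2).
Qed.

Lemma ln_P_lt n : (2 <= n)%N ->
  ln (n%:R * (n%:R ^+ 3 - 1)) < 4 * ln n%:R :> R.
Proof.
move=> n2; have n0 : 0 < n%:R :> R by rewrite ltr0n (leq_trans _ n2).
have n8 := natX3_ge8 n2.
rewrite [4 * _]mulr_natl -lnXn // ltr_ln ?posrE ?exprn_gt0
   ?mulr_gt0 ?subr_gt0 //.
  by rewrite [ltRHS]exprS ltr_pM2l // gtrBl.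
by apply: lt_le_trans n8; rewrite ltr1n.
Qed.

(** From [n ^ 3 >= 8] one gets [n ^ 3 - 1 >= n ^ 3 / 2]; multiply by [n] and take logarithms. *)
Lemma ln_P_ge n : (2 <= n)%N ->
  4 * ln n%:R - ln 2 <= ln (n%:R * (n%:R ^+ 3 - 1)) :> R.
Proof.
move=> n2; have n0 : 0 < n%:R :> R by rewrite ltr0n (leq_trans _ n2).
have n8 := natX3_ge8 n2.
have n31 : 0 < n%:R ^+ 3 - 1 :> R by lra.
rewrite [4 * _]mulr_natl -lnXn // -ln_div ?posrE ?exprn_gt0 //.
rewrite ler_ln ?posrE ?divr_gt0 ?exprn_gt0 ?mulr_gt0 //.
by rewrite exprS -mulrA ler_pM2l //; lra.
Qed.

Lemma ln_P_gt0 n : (2 <= n)%N -> 0 < ln (n%:R * (n%:R ^+ 3 - 1)) :> R.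
Proof.
move=> n2; have L0 := ln_natX_gt0 n2; have H := ln_P_ge n2.
have : ln 2 <= ln n%:R :> R.
  by rewrite ler_ln ?posrE ?ler_nat ?ltr0n // (leq_trans _ n2).
by lra.
Qed.

Lemma gain_family_gt n : (2 <= n)%N ->
  3 / 4 < approximation_gain R (family_triple n%:Z).
Proof.
move=> n2; rewrite gain_family // ltr_pdivlMr ?ln_P_gt0 //.
by have := ln_P_lt n2; lra.
Qed.

Lemma gain_family_le n : (2 <= n)%N ->
  approximation_gain R (family_triple n%:Z) <= 3 / 4 + ln 2 / ln n%:R.
Proof.
move=> n2; rewrite gain_family // ler_pdivrMr ?ln_P_gt0 //.
have L0 := ln_natX_gt0 n2; have H := ln_P_ge n2.
have l2 : ln 2 <= ln n%:R :> R.
  by rewrite ler_ln ?posrE ?ler_nat ?ltr0n // (leq_trans _ n2).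
have l20 : 0 < ln 2 :> R by rewrite ln_gt0 // ltr1n.
set q := ln 2 / _; have qE : q * ln n%:R = ln 2 by rewrite /q divfK // gt_eqF.
have q0 : 0 < q by rewrite divr_gt0.
apply: le_trans (ler_wpM2l _ H); last by lra.
(* With [ln 2 = q * ln n] the goal becomes [3 <= (3 / 4 + q) * (4 - q)] times [ln n]. The right side
   exceeds 3 by [q * (13 / 4 - q)], which is nonnegative for [0 < q <= 1]. *)
have : q <= 1 by rewrite ler_pdivrMr // mul1r.
by nra.
Qed.

Lemma cvg_gain_family :
  approximation_gain R (family_triple n%:Z) @[n --> \oo] --> (3 / 4 : R).
Proof.
apply/cvgrPdist_le => e e0; near=> n.
have n2 : (2 <= n)%N by near: n; exact: nbhs_infty_ge.
have n0 : 0 < n%:R :> R by rewrite ltr0n (leq_trans _ n2).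
(* For [n >= expR (ln 2 / e)] the error term [ln 2 / ln n] is at most [e]. *)
have Ln : ln 2 / e <= ln n%:R :> R.
  rewrite -[leLHS]expRK ler_ln ?posrE ?expR_gt0 //.
  by near: n; exact: nbhs_infty_ger.
have G1 := gain_family_gt n2; have G2 := gain_family_le n2.
rewrite distrC ger0_norm ?subr_ge0 ?(ltW G1) // lerBlDl.
apply: le_trans G2 _; rewrite lerD2l ler_pdivrMr ?ln_natX_gt0 //.
by rewrite mulrC -ler_pdivrMr.
Unshelve. all: by end_near. Qed.

(** The exponent decreases in [kappa] and equals [11 / 2 - 5 / 2 = 3] at [kappa = 6 / 11]. *)
Lemma gamma_exponent_le3 (kappa : R) :
  6 / 11 <= kappa -> gamma_exponent kappa <= 3.
Proof.
move=> k6; have k0 : 0 < kappa by apply: lt_le_trans k6; lra.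
by rewrite /gamma_exponent lerBlDr ler_pdivrMr //; lra.
Qed.

(** Taking logarithms in [n ^ 3 / 2 < n ^ a] gives [(3 - a) * ln n < ln 2], and [3 - a] is
    positive. *)
Lemma small_k_bound n (a : R) : (2 <= n)%N -> a < 3 ->
  n%:R ^+ 3 - 1 < n%:R `^ a -> n%:R < expR (ln 2 / (3 - a)).
Proof.
move=> n2 a3 H; have n0 : 0 < n%:R :> R by rewrite ltr0n (leq_trans _ n2).
have n8 := natX3_ge8 n2.
have : n%:R ^+ 3 / 2 < n%:R `^ a by apply: le_lt_trans H; lra.
rewrite -ltr_ln ?posrE ?divr_gt0 ?exprn_gt0 ?powR_gt0 //.
rewrite ln_div ?posrE ?exprn_gt0 // lnXn // ln_powR => H2.
rewrite -[ltLHS]lnK ?posrE // ltr_expR ltr_pdivlMr ?subr_gt0 //.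
by lra.
Qed.

(** Passes from integer to natural indices, for which the real estimates are stated. *)
Lemma family_setP (s : triple) : family_set s ->
  exists2 n : nat, (2 <= n)%N & s = family_triple n%:Z.
Proof. by move=> [[n|n] //= n2 <-]; exists n. Qed.

Lemma finite_small_k (a : R) : a < 3 ->
  finite_set (family_set `&`
    [set s | (`|tk s|)%:~R < (tx s)%:~R `^ a]).
Proof.
(* [N] is a natural number above the bound of [small_k_bound], so only indices below [N] can
   occur. *)
move=> a3; set N := Num.bound (expR (ln 2 / (3 - a)) : R).
apply: (@sub_finite_set _ _ ((fun n : nat => family_triple n%:Z) @` `I_N)).
  move=> s [/family_setP[n n2 ->]] /=; rewrite norm_tk_family // => H.
  exists n => //=; rewrite -(ltr_nat R).
  apply: lt_trans (small_k_bound n2 a3 H) _.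
  by rewrite archi_boundP ?expR_ge0.
exact/finite_image/finite_II.
Qed.

Lemma infinite_large_gain (c : R) : c <= 3 / 4 ->
  infinite_set (family_set `&` [set s | c < approximation_gain R s]).
Proof.
(* Every member of the family has gain above [3 / 4 >= c]. The shift by 2 lets all naturals serve as
   indices, and the first component makes the map injective. *)
move=> c34; apply: (@sub_infinite_set _
  ((fun n : nat => family_triple n.+2%:Z) @` setT)).
  move=> _ [n _ <-]; split; first by exists n.+2%:Z.
  exact: le_lt_trans c34 (gain_family_gt _).
rewrite (eq_finite_set (inj_card_eq _)); first exact: infinite_nat.
by move=> m n _ _ [].
Qed.

End Gain.

Theorem mainTheorem5 (R : realType) :
  (forall n : int, 2 <= n -> primitive_solution (family_triple n)) /\
  (approximation_gain R (family_triple n%:Z) @[n --> \oo] --> (3 / 4 : R)) /\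
  (forall kappa : R, 6 / 11 <= kappa -> kappa < 3 / 4 ->
     (forall delta : R, 0 < delta -> delta < gamma_exponent kappa ->
        finite_set (family_set `&`
          [set s | (`|tk s|)%:~R < (tx s)%:~R `^ (gamma_exponent kappa - delta)])) /\
     (forall epsilon : R, 0 < epsilon -> epsilon < 3 / 4 - kappa ->
        infinite_set (family_set `&`
          [set s | kappa + epsilon < approximation_gain R s]))).
Proof.
split; first exact: family_triple_primitive.
split; first exact: cvg_gain_family.
move=> kappa k6 k34; split=> [delta d0 _|epsilon e0 elt].
  (* Subtracting [delta > 0] brings the exponent strictly below 3. *)
  by apply: finite_small_k; have := gamma_exponent_le3 k6; lra.
by apply: infinite_large_gain; lra.
Qed.
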